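(* Let $V$ be a vector space over a field $\mathbb{F}$, let $n\ge 1$, let $D:V^n\to\mathbb{F}$ be an $n$-determinant on $V$, and let $v_1,\ldots,v_n\in V$ be linearly independent. Then for every $b\in V$ the linear equation $$x_1\cdot v_1+\ldots+x_n\cdot v_n=b$$ in the unknowns $x_1,\ldots,x_n\in\mathbb{F}$ has a unique solution, and it is given by $$x_k=\frac{D(v_1,\ldots,v_{k-1},b,v_{k+1},\ldots,v_n)}{D(v_1,\ldots,v_n)},\qquad k=1,\ldots,n.$$
   Context: Given a vector space $V$ over a field $\mathbb{F}$ and an integer $n\ge 1$, an $n$-determinant on $V$ is a function $D:V^n\to\mathbb{F}$ that is not identically zero, such that for all $v_1,\ldots,v_n,b\in V$ one has $$D(v_1,\ldots,v_n)\cdot b=\sum_{k=1}^n D(v_1,\ldots,v_{k-1},b,v_{k+1},\ldots,v_n)\cdot v_k,$$ and such that $V$ is not spanned by any $n-1$ vectors of $V$ (so that $V$ has dimension $n$ over $\mathbb{F}$). No linearity of $D$ is assumed in this definition. *)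

(* Defs.v *)
From mathcomp Require Import all_boot all_order all_algebra.

Set Implicit Arguments.
Unset Strict Implicit.
Unset Printing Implicit Defensive.

Import GRing.Theory.
Local Open Scope ring_scope.

(* V^n is {ffun 'I_n -> V}.  V is a bare lmodType, not a vectType: finite
   dimensionality is a consequence of having an n-determinant, so the vspace
   predicates [free] and [span] are not available here. *)

Definition lincomb (F : fieldType) (V : lmodType F) (n : nat)
    (x : {ffun 'I_n -> F}) (v : {ffun 'I_n -> V}) : V :=
  \sum_(k < n) x k *: v k.

Definition lin_indep (F : fieldType) (V : lmodType F) (n : nat)
    (v : {ffun 'I_n -> V}) : Prop :=
  forall x : {ffun 'I_n -> F}, lincomb x v = 0 -> forall k, x k = 0.

Definition spanning (F : fieldType) (V : lmodType F) (n : nat)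
    (v : {ffun 'I_n -> V}) : Prop :=
  forall u : V, exists x : {ffun 'I_n -> F}, lincomb x v = u.

Definition replace (V : Type) (n : nat) (v : {ffun 'I_n -> V}) (k : 'I_n)
    (b : V) : {ffun 'I_n -> V} :=
  [ffun i => if i == k then b else v i].

(* Meant for n >= 1 only, since n.-1 is truncated at 0. *)
Record is_ndeterminant (F : fieldType) (V : lmodType F) (n : nat)
    (D : {ffun 'I_n -> V} -> F) : Prop := IsNDeterminant {
  ndet_neq0 : exists v, D v != 0;
  ndet_exchange : forall (v : {ffun 'I_n -> V}) (b : V),
    D v *: b = \sum_(k < n) D (replace v k b) *: v k;
  ndet_not_spanned : forall w : {ffun 'I_n.-1 -> V}, ~ spanning w
}.

(* Main.v *)
(* Some tuple w has D w <> 0, hence spans V by the exchange identity, hence any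
   independent n-tuple u is a basis, as is w. If u is independent and D u = 0,
   the exchange identity forces D to vanish on every tuple obtained from u by
   changing a single entry. Any basis can be turned into w by changing one entry
   at a time through bases (Steinitz exchange), so D u = 0 would give D w = 0.
   Once D v <> 0, Cramer's formula is the exchange identity divided by D v. *)

Require Import Defs.
From mathcomp Require Import all_boot all_order all_algebra.

Set Implicit Arguments.
Unset Strict Implicit.
Unset Printing Implicit Defensive.

Import GRing.Theory.
Local Open Scope ring_scope.

Section LinearCombinations.

Variables (F : fieldType) (V : lmodType F) (n : nat).
Implicit Types (x y c : {ffun 'I_n -> F}) (u v w : {ffun 'I_n -> V}).

Lemma lincombB x y v : lincomb (x - y) v = lincomb x v - lincomb y v.
Proof.
by rewrite /lincomb -sumrB; apply: eq_bigr => i _; rewrite !ffunE scalerBl.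
Qed.

Lemma lincombD x y v : lincomb (x + y) v = lincomb x v + lincomb y v.
Proof.
by rewrite /lincomb -big_split; apply: eq_bigr => i _; rewrite !ffunE scalerDl.
Qed.

Lemma lincomb_single (a : F) k v :
  lincomb [ffun i => if i == k then a else 0] v = a *: v k.
Proof.
rewrite /lincomb (bigD1 k) //= ffunE eqxx big1 ?addr0 // => i ik.
by rewrite ffunE (negPf ik) scale0r.
Qed.

Lemma lincomb_replace x v k b :
  lincomb x (replace v k b) = lincomb x v + x k *: (b - v k).
Proof.
rewrite /lincomb (bigD1 k) //= [in RHS](bigD1 k) //= ffunE eqxx scalerBr.
rewrite [RHS]addrC addrA subrK; congr (_ + _).
by apply: eq_bigr => i ik; rewrite ffunE (negPf ik).
Qed.

Lemma lin_indep_inj v x y : lin_indep v -> lincomb x v = lincomb y v -> x = y.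
Proof.
move=> hv exy; apply/ffunP => k; apply/eqP; rewrite -subr_eq0.
have /(_ k) : forall k, (x - y) k = 0 by apply: hv; rewrite lincombB exy subrr.
by rewrite !ffunE => ->.
Qed.

Lemma lin_indep_replace v k c :
  lin_indep v -> c k != 0 -> lin_indep (replace v k (lincomb c v)).
Proof.
move=> hv ck x; rewrite lincomb_replace => hx.
pose y : {ffun 'I_n -> F} :=
  [ffun i => x i + x k * c i - (if i == k then x k else 0)].
have hy i : y i = 0.
  apply: hv; rewrite -hx scalerBr addrA.
  have -> : y = x + [ffun i => x k * c i] - [ffun i => if i == k then x k else 0].
    by apply/ffunP => j; rewrite !ffunE.
  rewrite lincombB lincombD lincomb_single; congr (_ + _ - _).
  by rewrite /lincomb scaler_sumr; apply: eq_bigr => j _; rewrite ffunE scalerA.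
have xk : x k = 0.
  move: (hy k); rewrite ffunE eqxx addrAC subrr add0r => /eqP.
  by rewrite mulf_eq0 (negPf ck) orbF => /eqP.
by move=> i; move: (hy i); rewrite ffunE xk mul0r addr0; case: ifP; rewrite subr0.
Qed.

Definition mxlincomb (A : 'M[F]_n) (v : {ffun 'I_n -> V}) : {ffun 'I_n -> V} :=
  [ffun i => \sum_j A i j *: v j].

Lemma lincomb_mxlincomb x (A : 'M[F]_n) v :
  lincomb x (mxlincomb A v) =
  lincomb [ffun j => ((\row_i x i) *m A) 0 j] v.
Proof.
rewrite /lincomb.
under eq_bigr do rewrite ffunE scaler_sumr.
rewrite exchange_big; apply: eq_bigr => j _ /=.
rewrite ffunE mxE scaler_suml; apply: eq_bigr => i _.
by rewrite scalerA mxE.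
Qed.

Lemma mxlincombM (A B : 'M[F]_n) v :
  mxlincomb A (mxlincomb B v) = mxlincomb (A *m B) v.
Proof.
apply/ffunP => i; rewrite !ffunE.
under eq_bigr do rewrite ffunE scaler_sumr.
rewrite exchange_big; apply: eq_bigr => j _ /=.
by rewrite mxE scaler_suml; apply: eq_bigr => k _; rewrite scalerA.
Qed.

Lemma mxlincomb1 v : mxlincomb 1%:M v = v.
Proof.
apply/ffunP => i; rewrite ffunE (bigD1 i) //= mxE eqxx scale1r.
rewrite big1 ?addr0 // => j ji.
by rewrite mxE eq_sym (negPf ji) scale0r.
Qed.

Lemma spanning_mxlincomb u w : spanning w -> exists A, u = mxlincomb A w.
Proof.
move=> hw; have [c hc] := fin_all_exists (fun i => hw (u i)).
exists (\matrix_(i, j) c i j); apply/ffunP => i.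
by rewrite ffunE -hc; apply: eq_bigr => j _; rewrite mxE.
Qed.

Lemma lin_indep_mxlincomb_unit (A : 'M[F]_n) w :
  lin_indep (mxlincomb A w) -> A \in unitmx.
Proof.
move=> hu; rewrite -row_free_unit; apply/inj_row_free => x xA0.
apply/rowP => i; rewrite mxE.
have := hu [ffun i => x 0 i] _ i; rewrite ffunE; apply.
rewrite lincomb_mxlincomb.
have -> : \row_j [ffun i => x 0 i] j = x by apply/rowP => j; rewrite mxE ffunE.
by rewrite xA0 /lincomb big1 // => j _; rewrite ffunE mxE scale0r.
Qed.

Lemma lin_indep_spanning u w : spanning w -> lin_indep u -> spanning u.
Proof.
move=> hw; have [A ->] := spanning_mxlincomb u hw => hu b.
have uA := lin_indep_mxlincomb_unit hu; have [x <-] := hw b.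
exists [ffun j => ((\row_i x i) *m invmx A) 0 j].
by rewrite -lincomb_mxlincomb mxlincombM mulVmx // mxlincomb1.
Qed.

Lemma spanning_lin_indep u w : spanning w -> lin_indep u -> lin_indep w.
Proof.
move=> hw hu; have [B ew] := spanning_mxlincomb w (lin_indep_spanning hw hu).
have [A eu] := spanning_mxlincomb u hw.
have uBA : u = mxlincomb (A *m B) u by rewrite -mxlincombM -ew.
have AB1 : A *m B = 1%:M.
  apply/row_matrixP => i; apply/rowP => j; rewrite !mxE.
  have := @lin_indep_inj u [ffun j => (A *m B) i j]
    [ffun j => if j == i then 1 else 0] hu.
  rewrite lincomb_single scale1r.
  have -> : lincomb [ffun j => (A *m B) i j] u = u i.
    rewrite [in RHS]uBA ffunE.
    by apply: eq_bigr => k _; rewrite ffunE.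
  move=> /(_ erefl) /ffunP /(_ j); rewrite !ffunE mxE => ->.
  by rewrite eq_sym; case: eqP.
move=> x; rewrite ew lincomb_mxlincomb => /hu hx k.
have xB0 : (\row_i x i) *m B = 0.
  by apply/rowP => j; move: (hx j); rewrite ffunE => ->; rewrite mxE.
have : (\row_i x i) = 0 :> 'rV[F]_n.
  by rewrite -[LHS]mulmx1 -(mulmx1C AB1) mulmxA xB0 mul0mx.
by move/rowP/(_ k); rewrite !mxE.
Qed.

(* If w k has coefficient 0 on u k, then w k cannot be put directly in place k;
   adding u k to another entry that still differs from w first makes that
   coefficient nonzero. *)
Lemma basis_exchange_ind (P : {ffun 'I_n -> V} -> Prop) w :
  spanning w ->
  (forall u k b, lin_indep u -> P u -> P (replace u k b)) ->
  forall u, lin_indep u -> P u -> P w.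
Proof.
move=> hw Prep u.
have [m] := ubnP #|[pred i | u i != w i]|.
elim: m u => // m IHm u lt_um hu Pu.
have [/forallP uw | /forallPn [k ukw]] := boolP [forall i, u i == w i].
  by suff <- : u = w by []; apply/ffunP => i; apply/eqP.
have decrease u' : u' k = w k -> (forall i, u i = w i -> u' i = w i) ->
    (#|[pred i | u' i != w i]| < m)%N.
  move=> u'k u'w; rewrite -ltnS; apply: leq_trans lt_um; rewrite ltnS.
  apply: proper_card; apply/properP; split.
    by apply/subsetP => i; rewrite !inE; apply: contraNneq => /u'w ->.
  by exists k; rewrite !inE ?u'k ?eqxx.
have step u' c : lin_indep u' -> P u' -> (forall i, u i = w i -> u' i = w i) ->
    lincomb c u' = w k -> c k != 0 -> P w.
  move=> hu' Pu' u'w cu' ck; apply: (IHm (replace u' k (w k))).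
  - apply: decrease; first by rewrite ffunE eqxx.
    by move=> i /u'w; rewrite ffunE; case: eqP => [->|].
  - by rewrite -cu'; apply: lin_indep_replace.
  - exact: Prep.
have [c hc] := lin_indep_spanning hw hu (w k).
have [ck0 | ck] := eqVneq (c k) 0; last exact: (step u c).
have [j /andP[cj ujw]] : exists j, (c j != 0) && (u j != w j).
  apply/existsP; rewrite -[X in is_true X]negbK negb_exists; apply/negP => /forallP uw.
  have ecw : lincomb c w = lincomb [ffun i => if i == k then 1 else 0] w.
    rewrite lincomb_single scale1r -hc; apply: eq_bigr => i _.
    move: (uw i); rewrite negb_and !negbK => /orP[/eqP ->|/eqP -> //].
    by rewrite !scale0r.
  have := lin_indep_inj (spanning_lin_indep hw hu) ecw.
  by move=> /ffunP/(_ k)/eqP; rewrite ffunE eqxx ck0 eq_sym oner_eq0.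
have jk : j != k by apply: contraNneq cj => ->; rewrite ck0.
pose e (i0 : 'I_n) (a : F) : {ffun 'I_n -> F} :=
  [ffun i => if i == i0 then a else 0].
have ejk : lincomb (e j 1 + e k 1) u = u j + u k.
  by rewrite lincombD !lincomb_single !scale1r.
apply: (step (replace u j (u j + u k)) (c - e k (c j))).
- rewrite -ejk; apply: lin_indep_replace => //.
  by rewrite !ffunE eqxx (negPf jk) addr0 oner_eq0.
- exact: Prep.
- by move=> i uiw; rewrite ffunE; case: eqP => // eij; rewrite -eij uiw eqxx in ujw.
- rewrite lincomb_replace lincombB lincomb_single hc !ffunE (negPf jk) subr0.
  by rewrite [u j + _]addrC addrK subrK.
- by rewrite !ffunE eqxx ck0 sub0r oppr_eq0.
Qed.

End LinearCombinations.

Section NDeterminants.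

Variables (F : fieldType) (V : lmodType F) (n : nat).
Variables (D : {ffun 'I_n -> V} -> F) (hD : is_ndeterminant D).

Lemma ndet_lincomb v b : D v != 0 ->
  lincomb [ffun k => D (replace v k b) / D v] v = b.
Proof.
move=> Dv0; rewrite -[RHS]scale1r -(mulVf Dv0) -scalerA (ndet_exchange hD).
rewrite scaler_sumr; apply: eq_bigr => k _.
by rewrite ffunE scalerA mulrC.
Qed.

Lemma ndet_replace_eq0 v k b :
  lin_indep v -> D v = 0 -> D (replace v k b) = 0.
Proof.
move=> hv Dv0; have := hv [ffun k => D (replace v k b)] _ k.
rewrite ffunE; apply; rewrite -[RHS](scale0r b) -Dv0 (ndet_exchange hD).
by apply: eq_bigr => i _; rewrite ffunE.
Qed.

Lemma lin_indep_ndet_neq0 v : lin_indep v -> D v != 0.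
Proof.
move=> hv; have [w Dw0] := ndet_neq0 hD.
have hw : spanning w.
  by move=> b; exists [ffun k => D (replace w k b) / D w]; apply: ndet_lincomb.
apply: contraNneq Dw0 => Dv0; apply/eqP.
apply: (basis_exchange_ind (P := fun u => D u = 0) hw _ hv Dv0).
by move=> u k b; apply: ndet_replace_eq0.
Qed.

End NDeterminants.

Theorem corollary2p10 (F : fieldType) (V : lmodType F) (n : nat)
    (hn : (1 <= n)%N) (D : {ffun 'I_n -> V} -> F) (hD : is_ndeterminant D)
    (v : {ffun 'I_n -> V}) (hv : lin_indep v) :
  D v != 0 /\
  forall b : V,
    (exists! x : {ffun 'I_n -> F}, lincomb x v = b) /\
    (forall x : {ffun 'I_n -> F}, lincomb x v = b ->
       forall k : 'I_n, x k = D (replace v k b) / D v).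
Proof.
have Dv0 := lin_indep_ndet_neq0 hD hv; split=> // b.
have hb := ndet_lincomb hD b Dv0.
split=> [|x hx k].
  by eexists; split=> [|x hx]; [exact: hb | apply: (lin_indep_inj hv); rewrite hb].
have -> : x = [ffun k => D (replace v k b) / D v].
  by apply: (lin_indep_inj hv); rewrite hx.
by rewrite ffunE.
Qed.
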